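(* Let $n\ge 3$ be an integer, let $\mathcal{G}=\begin{bmatrix}A&M\\ N&B\end{bmatrix}$ be a generalized matrix algebra over the commutative ring $\mathcal{R}$ and let $\varphi:\mathcal{G}^n\to\mathcal{G}$ be an $n$-Lie derivation. Suppose that: (1) $\pi_A(\mathcal{Z}(\mathcal{G}))=\mathcal{Z}(A)$ and $\pi_B(\mathcal{Z}(\mathcal{G}))=\mathcal{Z}(B)$; (2) at least one of the algebras $A$, $B$ does not contain nonzero central ideals; (3) if $\alpha a=0$ with $\alpha\in\mathcal{Z}(\mathcal{G})$ and $0\neq a\in\mathcal{G}$, then $\alpha=0$; (4) if $MN=0=NM$, then at least one of the algebras $A$ and $B$ is noncommutative; (5) every special pair of bimodule homomorphisms has standard form. Then $\varphi=\kappa+\psi$, where $\kappa$ is an extremal $n$-derivation given by $\kappa(x_1,\dots,x_n)=[x_1,[x_2,[\cdots,[x_n,X_0]\cdots]]]$ for all $x_1,\dots,x_n\in\mathcal{G}$, with $X_0=e\varphi(e,e,\dots,e)f+(-1)^n f\varphi(e,e,\dots,e)e$, and $\psi:\mathcal{G}^n\to\mathcal{Z}(\mathcal{G})$ is an $n$-linear central-valued mapping vanishing on commutators in each component (i.e. $\psi(x_1,\dots,x_n)=0$ whenever some $x_i$ is a commutator $[x,y]$ with $x,y\in\mathcal{G}$).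
   Context: $\mathcal{R}$ is a commutative ring with identity, assumed $2$-torsionfree. All algebras are associative $\mathcal{R}$-algebras; $[x,y]=xy-yx$ and $\mathcal{Z}(\cdot)$ denotes the center. A central ideal of an algebra is an ideal contained in its center. Generalized matrix algebra: let $A,B$ be unital $\mathcal{R}$-algebras, $M$ an $(A,B)$-bimodule, $N$ a $(B,A)$-bimodule (at least one of $M,N$ nonzero), and let $\Phi_{MN}:M\otimes_B N\to A$, $\Psi_{NM}:N\otimes_A M\to B$ be bimodule homomorphisms (write $mn=\Phi_{MN}(m\otimes n)$, $nm=\Psi_{NM}(n\otimes m)$) with $(mn)m'=m(nm')$ and $(nm)n'=n(mn')$ for all $m,m'\in M$, $n,n'\in N$ (a Morita context). Then $\mathcal{G}=\begin{bmatrix}A&M\\ N&B\end{bmatrix}$ is the $\mathcal{R}$-algebra of formal matrices with matrix addition and multiplication. Standing assumption: $M$ is faithful as a left $A$-module and as a right $B$-module (nothing is assumed on $N$). $A,M,N,B$ are identified with the corresponding corners of $\mathcal{G}$, so $\mathcal{G}=A+M+N+B$. Put $e=\begin{bmatrix}1_A&0\\0&0\end{bmatrix}$, $f=\begin{bmatrix}0&0\\0&1_B\end{bmatrix}$. The maps $\pi_A,\pi_B$ send $\begin{bmatrix}a&m\\ n&b\end{bmatrix}$ to $a$ and $b$ respectively. $MN=0$ (resp. $NM=0$) means $mn=0$ (resp. $nm=0$) for all $m\in M,n\in N$. A Lie derivation is an $\mathcal{R}$-linear map $\rho:\mathcal{G}\to\mathcal{G}$ with $\rho([x,y])=[\rho(x),y]+[x,\rho(y)]$.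 An $n$-Lie derivation is an $n$-linear map $\mathcal{G}^n\to\mathcal{G}$ that is a Lie derivation in each component (the others being fixed). An extremal $n$-derivation is an $n$-linear map of the form $(x_1,\dots,x_n)\mapsto[x_1,[x_2,\cdots,[x_n,X_0]\cdots]]$ for some $X_0\in\mathcal{G}$ with $[[x,y],X_0]=0$ for all $x,y\in\mathcal{G}$. A special pair $(\mathcal{F},\mathcal{E})$ consists of an $(A,B)$-bimodule homomorphism $\mathcal{F}:M\to M$ and a $(B,A)$-bimodule homomorphism $\mathcal{E}:N\to N$ with $\mathcal{F}(m)n+m\mathcal{E}(n)=0=n\mathcal{F}(m)+\mathcal{E}(n)m$ for all $m\in M,n\in N$. It has standard form if there are $\omega_0\in\mathcal{Z}(A)$, $\omega_1\in\mathcal{Z}(B)$ with $\mathcal{F}(m)=\omega_0m+m\omega_1$ and $\mathcal{E}(n)=-n\omega_0-\omega_1n$ for all $m\in M,n\in N$.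
   Formalization: The generalized matrix algebra G itself, not only the ring R, is assumed 2-torsionfree; with only R 2-torsionfree (e.g. R = Z and G an F_2-algebra) the claim fails. *)

(* Defs.v *)
From HB Require Import structures.
From mathcomp Require Import all_boot all_algebra.

Set Implicit Arguments.
Unset Strict Implicit.
Unset Printing Implicit Defensive.

Import GRing.Theory.
Local Open Scope ring_scope.

Definition two_torsion_free (V : zmodType) : Prop :=
  forall v : V, v *+ 2 = 0 -> v = 0.

Section Ring.
Variable S : pzRingType.

Definition lie (x y : S) : S := x * y - y * x.

Definition central (z : S) : Prop := forall x, z * x = x * z.

(* Over an R-algebra, I is automatically R-stable: k *: x = (k *: 1) * x. *)
Definition two_sided_ideal (I : S -> Prop) : Prop :=
  [/\ I 0, forall x y, I x -> I y -> I (x + y),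
      forall a x, I x -> I (a * x) & forall a x, I x -> I (x * a)].

Definition central_ideal (I : S -> Prop) : Prop :=
  two_sided_ideal I /\ forall x, I x -> central x.

Definition no_nonzero_central_ideal : Prop :=
  forall I : S -> Prop, central_ideal I -> forall x, I x -> x = 0.

Definition commutative_ring : Prop := forall x y : S, x * y = y * x.

End Ring.

(* An (A, B)-bimodule.  R acts through both algebras (lactZ, ractZ), and this
   action is the given R-module structure. *)
Record bimodule (R : comPzRingType) (A B : algType R) := Bimodule {
  bimod_sort :> lmodType R;
  lact : A -> bimod_sort -> bimod_sort;
  ract : bimod_sort -> B -> bimod_sort;
  lact1 : forall m, lact 1 m = m;
  lactA : forall a a' m, lact a (lact a' m) = lact (a * a') m;
  lactDl : forall a a' m, lact (a + a') m = lact a m + lact a' m;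
  lactDr : forall a m m', lact a (m + m') = lact a m + lact a m';
  lactZ : forall k a m, lact (k *: a) m = k *: lact a m;
  ract1 : forall m, ract m 1 = m;
  ractA : forall m b b', ract (ract m b) b' = ract m (b * b');
  ractDl : forall m m' b, ract (m + m') b = ract m b + ract m' b;
  ractDr : forall m b b', ract m (b + b') = ract m b + ract m b';
  ractZ : forall k b m, ract m (k *: b) = k *: ract m b;
  lractA : forall a m b, ract (lact a m) b = lact a (ract m b)
}.

Notation "a *> m" := (lact a m) (at level 40, left associativity) : ring_scope.
Notation "m <* b" := (ract m b) (at level 40, left associativity) : ring_scope.

Section BimoduleTheory.
Variables (R : comPzRingType) (A B : algType R) (M : bimodule A B).
Implicit Types (a : A) (b : B) (m : M) (k : R).

Definition left_faithful : Prop :=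
  forall a, (forall m, a *> m = 0) -> a = 0.
Definition right_faithful : Prop :=
  forall b, (forall m, m <* b = 0) -> b = 0.
Definition nonzero_module : Prop := exists m : M, m <> 0.

(* R-linearity is a consequence: k *: m = (k *: 1) *> m. *)
Definition bimodule_hom (F : M -> M) : Prop :=
  [/\ {morph F : m m' / m + m'}, forall a m, F (a *> m) = a *> F m
    & forall m b, F (m <* b) = F m <* b].

Lemma scale_lact k m : k *: m = (k *: 1) *> m.
Proof. by rewrite lactZ lact1. Qed.

Lemma scale_ract k m : k *: m = m <* (k *: 1).
Proof. by rewrite ractZ ract1. Qed.

Lemma lactZr a k m : a *> (k *: m) = k *: (a *> m).
Proof. by rewrite scale_lact lactA -scalerAr mulr1 lactZ. Qed.

Lemma ractZl m k b : (k *: m) <* b = k *: (m <* b).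
Proof. by rewrite scale_ract ractA -scalerAl mul1r ractZ. Qed.

Lemma lact0 a : a *> (0 : M) = 0.
Proof. by apply: (addIr (a *> (0 : M))); rewrite -lactDr !add0r. Qed.

Lemma ract0 b : (0 : M) <* b = 0.
Proof. by apply: (addIr ((0 : M) <* b)); rewrite -ractDl !add0r. Qed.

Lemma lact0l m : 0 *> m = 0.
Proof. by apply: (addIr (0 *> m)); rewrite -lactDl !add0r. Qed.

Lemma ract0r m : m <* 0 = 0.
Proof. by apply: (addIr (m <* 0)); rewrite -ractDr !add0r. Qed.

End BimoduleTheory.

(* A bimodule homomorphism out of M (x)_B N is, by the universal property of
   the tensor product, a biadditive B-balanced pairing that is A-linear on
   both sides; likewise for N (x)_A M. *)
Record morita_context (R : comPzRingType) (A B : algType R)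
    (M : bimodule A B) (N : bimodule B A) := MoritaContext {
  mulMN : M -> N -> A;
  mulNM : N -> M -> B;
  mulMNDl : forall m m' n, mulMN (m + m') n = mulMN m n + mulMN m' n;
  mulMNDr : forall m n n', mulMN m (n + n') = mulMN m n + mulMN m n';
  mulMN_balanced : forall m b n, mulMN (m <* b) n = mulMN m (b *> n);
  mulMN_lact : forall a m n, mulMN (a *> m) n = a * mulMN m n;
  mulMN_ract : forall m n a, mulMN m (n <* a) = mulMN m n * a;
  mulNMDl : forall n n' m, mulNM (n + n') m = mulNM n m + mulNM n' m;
  mulNMDr : forall n m m', mulNM n (m + m') = mulNM n m + mulNM n m';
  mulNM_balanced : forall n a m, mulNM (n <* a) m = mulNM n (a *> m);
  mulNM_lact : forall b n m, mulNM (b *> n) m = b * mulNM n m;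
  mulNM_ract : forall n m b, mulNM n (m <* b) = mulNM n m * b;
  mulMNM : forall m n m', mulMN m n *> m' = m <* mulNM n m';
  mulNMN : forall n m n', mulNM n m *> n' = n <* mulMN m n'
}.

(* The generalized matrix [partA, partM; partN, partB]. *)
Record gmatrix (R : comPzRingType) (A B : algType R) (M : bimodule A B)
    (N : bimodule B A) (C : morita_context M N) := GMatrix {
  partA : A; partM : M; partN : N; partB : B
}.

Section GMatrixAlgebra.
Variables (R : comPzRingType) (A B : algType R).
Variables (M : bimodule A B) (N : bimodule B A) (C : morita_context M N).
Local Notation G := (gmatrix C).
Implicit Types (x y z : G) (k : R).

Local Notation mk := (@GMatrix R A B M N C).

Definition gm_tuple x : A * M * N * B :=
  (partA x, partM x, partN x, partB x).
Definition tuple_gm (t : A * M * N * B) : G :=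
  mk t.1.1.1 t.1.1.2 t.1.2 t.2.
Lemma gm_tupleK : cancel gm_tuple tuple_gm.
Proof. by case. Qed.

HB.instance Definition _ := Choice.copy G (can_type gm_tupleK).

Lemma gmP x y : partA x = partA y -> partM x = partM y ->
  partN x = partN y -> partB x = partB y -> x = y.
Proof. by case: x y => a m n b [a' m' n' b'] /= -> -> -> ->. Qed.

Definition gm_zero : G := mk 0 0 0 0.
Definition gm_opp x : G :=
  mk (- partA x) (- partM x) (- partN x) (- partB x).
Definition gm_add x y : G :=
  mk (partA x + partA y) (partM x + partM y)
     (partN x + partN y) (partB x + partB y).

Lemma gm_addA : associative gm_add.
Proof. by move=> x y z; apply: gmP => /=; rewrite addrA. Qed.
Lemma gm_addC : commutative gm_add.
Proof. by move=> x y; apply: gmP => /=; rewrite addrC. Qed.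
Lemma gm_add0 : left_id gm_zero gm_add.
Proof. by move=> x; apply: gmP => /=; rewrite add0r. Qed.
Lemma gm_addN : left_inverse gm_zero gm_opp gm_add.
Proof. by move=> x; apply: gmP => /=; rewrite addNr. Qed.

HB.instance Definition _ :=
  GRing.isZmodule.Build G gm_addA gm_addC gm_add0 gm_addN.

Definition gm_one : G := mk 1 0 0 1.
Definition gm_mul x y : G :=
  mk (partA x * partA y + mulMN C (partM x) (partN y))
     (partA x *> partM y + partM x <* partB y)
     (partN x <* partA y + partB x *> partN y)
     (mulNM C (partN x) (partM y) + partB x * partB y).

Let mulMN0 m : mulMN C m 0 = 0.
Proof. by apply: (addIr (mulMN C m 0)); rewrite -mulMNDr !add0r. Qed.
Let mul0MN n : mulMN C 0 n = 0.
Proof. by apply: (addIr (mulMN C 0 n)); rewrite -mulMNDl !add0r. Qed.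
Let mulNM0 n : mulNM C n 0 = 0.
Proof. by apply: (addIr (mulNM C n 0)); rewrite -mulNMDr !add0r. Qed.
Let mul0NM m : mulNM C 0 m = 0.
Proof. by apply: (addIr (mulNM C 0 m)); rewrite -mulNMDl !add0r. Qed.

Lemma gm_mulA : associative gm_mul.
Proof.
move=> x y z; apply: gmP => /=.
- rewrite mulrDr mulrDl mulMNDr mulMNDl mulMN_ract mulMN_lact.
  by rewrite mulMN_balanced mulrA addrACA.
- by rewrite lactDr lactDl ractDr ractDl lactA ractA lractA mulMNM addrACA.
- by rewrite lactDr lactDl ractDr ractDl lactA ractA lractA mulNMN addrACA.
- rewrite mulrDr mulrDl mulNMDr mulNMDl mulNM_ract mulNM_lact.
  by rewrite mulNM_balanced mulrA addrACA.
Qed.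
Lemma gm_mul1 : left_id gm_one gm_mul.
Proof.
move=> x; apply: gmP => /=;
  by rewrite ?mul0MN ?mul0NM ?mul1r ?lact1 ?ract0 ?addr0 ?add0r.
Qed.
Lemma gm_mulr1 : right_id gm_one gm_mul.
Proof.
move=> x; apply: gmP => /=;
  by rewrite ?mulMN0 ?mulNM0 ?mulr1 ?ract1 ?lact0 ?addr0 ?add0r.
Qed.
Lemma gm_mulDl : left_distributive gm_mul +%R.
Proof.
move=> x y z; apply: gmP => /=;
  by rewrite ?mulMNDl ?mulNMDl ?mulrDl ?lactDl ?ractDl addrACA.
Qed.
Lemma gm_mulDr : right_distributive gm_mul +%R.
Proof.
move=> x y z; apply: gmP => /=;
  by rewrite ?mulMNDr ?mulNMDr ?mulrDr ?lactDr ?ractDr addrACA.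
Qed.
Lemma gm_oner_neq0 : gm_one != 0 :> G.
Proof. by apply/eqP => /(congr1 (@partA _ _ _ _ _ _)) /eqP; rewrite /= oner_eq0. Qed.

HB.instance Definition _ := GRing.Zmodule_isNzRing.Build G
  gm_mulA gm_mul1 gm_mulr1 gm_mulDl gm_mulDr gm_oner_neq0.

Definition gm_scale k x : G :=
  mk (k *: partA x) (k *: partM x) (k *: partN x) (k *: partB x).

Lemma gm_scaleA k l x : gm_scale k (gm_scale l x) = gm_scale (k * l) x.
Proof. by apply: gmP => /=; rewrite scalerA. Qed.
Lemma gm_scale1 : left_id 1 gm_scale.
Proof. by move=> x; apply: gmP => /=; rewrite scale1r. Qed.
Lemma gm_scaleDr : right_distributive gm_scale +%R.
Proof. by move=> k x y; apply: gmP => /=; rewrite scalerDr. Qed.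
Lemma gm_scaleDl x : {morph gm_scale^~ x : k l / k + l}.
Proof. by move=> k l; apply: gmP => /=; rewrite scalerDl. Qed.

HB.instance Definition _ := GRing.Zmodule_isLmodule.Build R G
  gm_scaleA gm_scale1 gm_scaleDr gm_scaleDl.

Let mulMNZl k m n : mulMN C (k *: m) n = k *: mulMN C m n.
Proof. by rewrite scale_lact mulMN_lact -scalerAl mul1r. Qed.
Let mulMNZr k m n : mulMN C m (k *: n) = k *: mulMN C m n.
Proof. by rewrite scale_ract mulMN_ract -scalerAr mulr1. Qed.
Let mulNMZl k n m : mulNM C (k *: n) m = k *: mulNM C n m.
Proof. by rewrite scale_lact mulNM_lact -scalerAl mul1r. Qed.
Let mulNMZr k n m : mulNM C n (k *: m) = k *: mulNM C n m.
Proof. by rewrite scale_ract mulNM_ract -scalerAr mulr1. Qed.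

Lemma gm_scaleAl k x y : k *: (x * y) = (k *: x) * y.
Proof.
apply: gmP => /=;
  by rewrite scalerDr ?lactZ ?ractZl ?mulMNZl ?mulNMZl ?scalerAl.
Qed.
HB.instance Definition _ := GRing.Lmodule_isLalgebra.Build R G gm_scaleAl.

Lemma gm_scaleAr k x y : k *: (x * y) = x * (k *: y).
Proof.
apply: gmP => /=;
  by rewrite scalerDr ?lactZr ?ractZ ?mulMNZr ?mulNMZr ?scalerAr.
Qed.
HB.instance Definition _ := GRing.Lalgebra_isAlgebra.Build R G gm_scaleAr.

Definition gm_e : G := mk 1 0 0 0.
Definition gm_f : G := mk 0 0 0 1.

Definition MN_zero : Prop := forall m n, mulMN C m n = 0.
Definition NM_zero : Prop := forall n m, mulNM C n m = 0.

Definition special_pair (F : M -> M) (E : N -> N) : Prop :=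
  [/\ bimodule_hom F, bimodule_hom E,
      forall m n, mulMN C (F m) n + mulMN C m (E n) = 0
    & forall m n, mulNM C n (F m) + mulNM C (E n) m = 0].

Definition standard_form (F : M -> M) (E : N -> N) : Prop :=
  exists (w0 : A) (w1 : B),
    [/\ central w0, central w1,
        forall m, F m = w0 *> m + m <* w1
      & forall n, E n = - (n <* w0) - (w1 *> n)].

End GMatrixAlgebra.

Section MultilinearMaps.
Variables (R : comPzRingType) (G : algType R) (n : nat).
Implicit Types (x : {ffun 'I_n -> G}) (phi : {ffun 'I_n -> G} -> G).

Definition subst_arg x (i : 'I_n) (y : G) : {ffun 'I_n -> G} :=
  [ffun j => if j == i then y else x j].

Definition nlinear phi : Prop :=
  forall x i, linear (fun y => phi (subst_arg x i y)).

Definition lie_derivation (rho : G -> G) : Prop :=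
  linear rho /\
  forall x y : G, rho (lie x y) = lie (rho x) y + lie x (rho y).

Definition n_lie_derivation phi : Prop :=
  nlinear phi /\
  forall x i, lie_derivation (fun y => phi (subst_arg x i y)).

(* [x_0, [x_1, ... [x_(n-1), X0] ... ]]: \big is a right fold, and X0 is the
   value on the empty range; lie is not a monoid law. *)
Definition iterated_lie (X0 : G) x : G := \big[@lie G/X0]_(i < n) x i.

Definition extremal_at (X0 : G) (kappa : {ffun 'I_n -> G} -> G) : Prop :=
  [/\ nlinear kappa, forall x y : G, lie (lie x y) X0 = 0
    & forall x, kappa x = iterated_lie X0 x].

Definition vanishes_on_commutators phi : Prop :=
  forall x i, (exists y z : G, x i = lie y z) -> phi x = 0.

End MultilinearMaps.

(* Main.v *)
Require Import Defs.
From mathcomp Require Import all_boot all_algebra.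

Set Implicit Arguments.
Unset Strict Implicit.
Unset Printing Implicit Defensive.

Import GRing.Theory.
Local Open Scope ring_scope.

(** Commutation with the idempotent e grades the algebra: [e, -] is 1 on M, -1
    on N and 0 on the diagonal A + B.  A Lie derivation rho takes e to a
    diagonal part that is central, plus something in M + N ([lie_der_diag]);
    when rho e is central, rho commutes with [e, -] and so respects the grading.

    The value X of phi at (e, ..., e) has corners p in M and q in N.  Varying
    two arguments only, the products m q and q m turn out to be the two parts
    of a central element, so that M q and q M are central ideals of A and B; one
    of them is zero, and then so is the other.  The same holds for p N and N p.
    Together with the relation [biderivation_interchange] this shows that p and
    q commute with all commutators ([extremal_ee]).  The iterated bracket with
    X0 is thus an n-Lie derivation; its value at (e, ..., e) is p + q, the sign
    in X0 making up for the n brackets [e, -].  Subtracting it leaves an n-Lie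
    derivation psi with psi(e, ..., e) central, and it remains to see that psi
    is central-valued: a central-valued n-Lie derivation kills commutators.

    Modulo the center, a Lie derivation with rho e central and with central
    values on the diagonal induces a special pair, hence is alpha [e, -]
    with alpha central ([lie_der_scalar]).  For a Lie biderivation D with
    D(e, e) central this gives D(x, e) = alpha [e, x] = - D(e, x) modulo the
    center ([biderivation_scalar]): the two scalars are opposite because their
    sum annihilates enough commutators.  The obstruction alpha is genuine with
    two arguments, as alpha [x, y] shows, but a third argument destroys it:
    moving e around three places changes the sign of alpha, so 2 alpha = 0
    ([triderivation_central_ee]), and for a third argument z other than e one
    still finds alpha [e, z] = 0, which forces alpha = 0
    ([triderivation_central_e]).  Hence psi is central as soon as one argument
    is e, by induction on the number of other arguments.  A last computation on
    two places ([biderivation_central]) removes the remaining e. *)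

(** * Commutators and the center of a ring *)

Section LieRing.
Variable S : pzRingType.
Implicit Types x y z u v : S.

Lemma lieDl x y z : lie (x + y) z = lie x z + lie y z.
Proof. by rewrite /lie mulrDl mulrDr opprD addrACA. Qed.

Lemma lieDr x y z : lie z (x + y) = lie z x + lie z y.
Proof. by rewrite /lie mulrDl mulrDr opprD addrACA. Qed.

Lemma lieNl x y : lie (- x) y = - lie x y.
Proof. by rewrite /lie mulNr mulrN opprB opprK addrC. Qed.

Lemma lieNr x y : lie x (- y) = - lie x y.
Proof. by rewrite /lie mulNr mulrN opprB opprK addrC. Qed.

Lemma lieBl x y z : lie (x - y) z = lie x z - lie y z.
Proof. by rewrite lieDl lieNl. Qed.

Lemma lieBr x y z : lie z (x - y) = lie z x - lie z y.
Proof. by rewrite lieDr lieNr. Qed.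

Lemma lieC x y : lie x y = - lie y x.
Proof. by rewrite /lie opprB. Qed.

Lemma liexx x : lie x x = 0.
Proof. exact: subrr. Qed.

Lemma lie0r x : lie x 0 = 0.
Proof. by rewrite /lie mulr0 mul0r subrr. Qed.

Lemma lie_jacobi x y z : lie x (lie y z) = lie (lie x y) z + lie y (lie x z).
Proof.
rewrite /lie !mulrBr !mulrBl !mulrA !opprB [RHS]addrACA !subrKA.
by rewrite [X in _ + X = _]addrC addrACA [X in _ + X = _]addrC.
Qed.

Lemma lie_centrall z x : central z -> lie z x = 0.
Proof. by move=> cz; rewrite /lie cz subrr. Qed.

Lemma lie_centralr z x : central z -> lie x z = 0.
Proof. by move=> cz; rewrite /lie cz subrr. Qed.

Lemma central0 : central (0 : S).
Proof. by move=> x; rewrite mul0r mulr0. Qed.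

Lemma centralD z z' : central z -> central z' -> central (z + z').
Proof. by move=> cz cz' x; rewrite mulrDl mulrDr cz cz'. Qed.

Lemma centralN z : central z -> central (- z).
Proof. by move=> cz x; rewrite mulNr mulrN cz. Qed.

Lemma centralB z z' : central z -> central z' -> central (z - z').
Proof. by move=> cz /centralN; apply: centralD. Qed.

Lemma lie_eql x y u : central (x - y) -> lie x u = lie y u.
Proof.
by move=> /(lie_centrall u); rewrite lieBl => /eqP; rewrite subr_eq0 => /eqP.
Qed.

Lemma lieMl z x y : central z -> lie (z * x) y = z * lie x y.
Proof. by move=> cz; rewrite /lie mulrBr !mulrA -(cz y). Qed.

Lemma lieMr z x y : central z -> lie x (z * y) = z * lie x y.
Proof. by move=> cz; rewrite /lie mulrBr !mulrA -(cz x). Qed.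

End LieRing.

(** * Lie derivations and Lie biderivations *)

Section LieDerivations.
Variables (R : comPzRingType) (G : algType R).
Implicit Types (rho : G -> G) (D : G -> G -> G) (x y u v X : G).

Section One.
Variable rho : G -> G.
Hypothesis rho_der : lie_derivation rho.

Lemma lie_derD x y : rho (x + y) = rho x + rho y.
Proof. by have := rho_der.1 1 x y; rewrite !scale1r. Qed.

Lemma lie_der0 : rho 0 = 0.
Proof. by apply: (addIr (rho 0)); rewrite -lie_derD !add0r. Qed.

Lemma lie_derN x : rho (- x) = - rho x.
Proof. by apply: (addIr (rho x)); rewrite -lie_derD !addNr lie_der0. Qed.

Lemma lie_derL x y : rho (lie x y) = lie (rho x) y + lie x (rho y).
Proof. exact: rho_der.2. Qed.

End One.

Definition lie_biderivation D : Prop :=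
  (forall y, lie_derivation (D^~ y)) /\ (forall x, lie_derivation (D x)).

(** The value of D at ([x,u],[y,v]) can be expanded by the Leibniz rule in the
    first argument first or in the second one first.  Up to the Jacobi identity
    both expansions share the four double brackets, and what is left over is
    this relation. *)
Lemma biderivation_interchange D x y u v : lie_biderivation D ->
  lie (D x y) (lie u v) + lie (D u v) (lie x y) =
  lie (D x v) (lie u y) + lie (D u y) (lie x v).
Proof.
case=> D1 D2.
have Dl z w t : D (lie z w) t = lie (D z t) w + lie z (D w t).
  exact: lie_derL (D1 t) z w.
have Dr z w t : D t (lie z w) = lie (D t z) w + lie z (D t w).
  exact: lie_derL (D2 t) z w.
have cancel (a b c d p q r k : G) :
    (a + b) + ((c + r) + (k + d)) = ((p + a) + c) + ((b + q) + d) ->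
    r + k = p + q.
  rewrite [LHS](AC (2*(2*2)) ((4*5)*((1*2)*(3*6)))) /= => eq_sums.
  apply: (addIr ((a + b) + (c + d))); rewrite eq_sums.
  by rewrite [LHS](AC (3*3) ((1*5)*((2*4)*(3*6)))).
have : D (lie x u) (lie y v) = lie (D (lie x u) y) v + lie y (D (lie x u) v).
  exact: Dr.
(* Only four sums may be expanded: a commutator is itself a difference. *)
rewrite Dl !Dr !Dl !(lieDl (lie _ _) (lie _ _)) !(lieDr (lie _ _) (lie _ _)).
rewrite (lie_jacobi x (D u y)) (lie_jacobi x y) (lie_jacobi y (D x v)).
have -> : lie (lie (D x y) u) v = lie (D x y) (lie u v) + lie (lie (D x y) v) u.
  by rewrite (lie_jacobi (D x y)) -addrA [lie u _]lieC addNr addr0.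
move/cancel => eqD.
rewrite [lie (D u v) _]lieC [lie u y]lieC lieNr.
by apply/eqP; rewrite subr_eq -addrA eqD addrCA addNr addr0.
Qed.

Lemma sub_lie_derivation rho sigma : lie_derivation rho ->
  lie_derivation sigma -> lie_derivation (fun x => rho x - sigma x).
Proof.
move=> [rl rD] [sl sD]; split=> [k x y|x y].
  by rewrite rl sl scalerBr opprD addrACA.
by rewrite rD sD lieBl lieBr opprD addrACA.
Qed.

Lemma lie_derivation_inner X : lie_derivation (fun y => lie y X).
Proof.
split=> [k x y|x y]; first by rewrite lieDl /lie scalerBr scalerAl scalerAr.
by rewrite [lie (lie x X) y]lieC (lie_jacobi x) addrCA addNr addr0.
Qed.

End LieDerivations.

(** * Multilinear maps and extremal derivations *)

Section MultiLie.
Variables (R : comPzRingType) (G : algType R) (p : nat).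
Implicit Types (x : {ffun 'I_p -> G}) (phi : {ffun 'I_p -> G} -> G).
Implicit Types (i j l : 'I_p) (a b c u v X : G).

Lemma subst_arg_id x i a : x i = a -> subst_arg x i a = x.
Proof.
by move=> xi; apply/ffunP => j; rewrite ffunE; case: eqP => // ->.
Qed.

Lemma subst_argC x i j a b : i != j ->
  subst_arg (subst_arg x i a) j b = subst_arg (subst_arg x j b) i a.
Proof.
move=> nij; apply/ffunP => l; rewrite !ffunE.
by case: (eqVneq l j) => // ->; rewrite eq_sym (negPf nij).
Qed.

Lemma sub_n_lie_derivation phi phi' : n_lie_derivation phi ->
  n_lie_derivation phi' -> n_lie_derivation (fun x => phi x - phi' x).
Proof.
move=> [_ d] [_ d'].
have dd x i : lie_derivation
    (fun y => phi (subst_arg x i y) - phi' (subst_arg x i y)).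
  exact: sub_lie_derivation (d x i) (d' x i).
by split=> // x i; have [] := dd x i.
Qed.

Lemma n_lie_bider phi x i j : n_lie_derivation phi -> i != j ->
  lie_biderivation (fun a b => phi (subst_arg (subst_arg x i a) j b)).
Proof.
move=> [_ d] nij; split=> [b|a]; last exact: d.
by split=> [k a a'|a a']; rewrite !(subst_argC _ _ _ nij);
  [apply: (d _ _).1 | apply: (d _ _).2].
Qed.

(** On the ideal of these elements the Lie algebra acts by commuting
    operators. *)
Definition extremal_elt X : Prop := forall u v, lie (lie u v) X = 0.

Lemma extremal_lieC X u v :
  extremal_elt X -> lie u (lie v X) = lie v (lie u X).
Proof. by move=> extX; rewrite lie_jacobi extX add0r. Qed.

Lemma extremal_lie X u : extremal_elt X -> extremal_elt (lie u X).
Proof.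
by move=> extX v w; rewrite (lie_jacobi _ u) !extX lie0r addr0.
Qed.

Section Extremal.
Variables (X0 : G) (extX0 : extremal_elt X0).

Lemma big_lie_rem x (r : seq 'I_p) i : i \in r ->
  \big[@lie G/X0]_(j <- r) x j = lie (x i) (\big[@lie G/X0]_(j <- rem i r) x j).
Proof.
have ext (s : seq 'I_p) : extremal_elt (\big[@lie G/X0]_(j <- s) x j).
  by elim: s => [|j s IH]; rewrite ?big_nil // big_cons; apply: extremal_lie.
elim: r => // j r IH; rewrite inE big_cons /= eq_sym.
have [-> //|_ /= /IH ->] := eqVneq j i.
by rewrite big_cons extremal_lieC.
Qed.

(** The brackets with the arguments commute, so any argument can be moved to
    the outermost position. *)
Lemma iterated_lie_subst x i :
  exists W, forall a, iterated_lie X0 (subst_arg x i a) = lie a W.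
Proof.
exists (\big[@lie G/X0]_(j <- rem i (index_enum 'I_p)) x j) => a.
rewrite /iterated_lie (big_lie_rem _ (mem_index_enum i)) ffunE eqxx.
congr (lie a _); apply: eq_big_seq => j.
by rewrite mem_rem_uniq ?index_enum_uniq // inE ffunE => /andP[/negPf->].
Qed.

Lemma iterated_lie_n_derivation : n_lie_derivation (@iterated_lie R G p X0).
Proof.
have d x i : lie_derivation (fun a => iterated_lie X0 (subst_arg x i a)).
  have [W eW] := iterated_lie_subst x i; have [Wl WD] := lie_derivation_inner W.
  by split=> [k a b|a b] /=; rewrite !eW; [apply: Wl | apply: WD].
by split=> // x i; have [] := d x i.
Qed.

Lemma extremal_iterated_lie : extremal_at X0 (@iterated_lie R G p X0).
Proof. by split=> //; case: iterated_lie_n_derivation. Qed.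

End Extremal.

(** Both terms of the Leibniz rule are brackets with central values. *)
Lemma n_lie_central_commutator phi : n_lie_derivation phi ->
  (forall x, central (phi x)) -> vanishes_on_commutators phi.
Proof.
move=> [_ d] cphi x i [u [v xi]].
rewrite -(subst_arg_id xi) (d x i).2.
by rewrite lie_centrall // lie_centralr // addr0.
Qed.

End MultiLie.

(** * The Peirce grading of a generalized matrix algebra *)

Section PeirceGrading.
Variables (R : comPzRingType) (A B : algType R).
Variables (M : bimodule A B) (N : bimodule B A) (C : morita_context M N).
Local Notation G := (gmatrix C).
Local Notation e := (gm_e C).
Local Notation f := (gm_f C).
Implicit Types (a : A) (b : B) (m : M) (n : N) (x y z u v : G).

Definition inA a : G := GMatrix C a 0 0 0.
Definition inM m : G := GMatrix C 0 m 0 0.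
Definition inN n : G := GMatrix C 0 0 n 0.
Definition inB b : G := GMatrix C 0 0 0 b.
Definition diag x : G := GMatrix C (partA x) 0 0 (partB x).

Lemma mulMN0 m : mulMN C m 0 = 0.
Proof. by apply: (addIr (mulMN C m 0)); rewrite -mulMNDr !add0r. Qed.

Lemma mul0MN n : mulMN C 0 n = 0.
Proof. by apply: (addIr (mulMN C 0 n)); rewrite -mulMNDl !add0r. Qed.

Lemma mulNM0 n : mulNM C n 0 = 0.
Proof. by apply: (addIr (mulNM C n 0)); rewrite -mulNMDr !add0r. Qed.

Lemma mul0NM m : mulNM C 0 m = 0.
Proof. by apply: (addIr (mulNM C 0 m)); rewrite -mulNMDl !add0r. Qed.

Lemma lactBl (A' B' : algType R) (M' : bimodule A' B') (a a' : A') (m : M') :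
  (a - a') *> m = a *> m - a' *> m.
Proof. by apply: (addIr (a' *> m)); rewrite -lactDl !subrK. Qed.

Lemma ractBr (A' B' : algType R) (M' : bimodule A' B') (b b' : B') (m : M') :
  m <* (b - b') = m <* b - m <* b'.
Proof. by apply: (addIr (m <* b')); rewrite -ractDr !subrK. Qed.

Definition null_simp := (lact0, ract0, lact0l, ract0r, lact1, ract1, mulMN0,
  mul0MN, mulNM0, mul0NM, mulr0, mul0r, mulr1, mul1r, addr0, add0r, oppr0,
  subr0, sub0r).

Lemma partA_lie x y : partA (lie x y) =
  (partA x * partA y + mulMN C (partM x) (partN y)) -
  (partA y * partA x + mulMN C (partM y) (partN x)).
Proof. by []. Qed.

Lemma partB_lie x y : partB (lie x y) =
  (mulNM C (partN x) (partM y) + partB x * partB y) -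
  (mulNM C (partN y) (partM x) + partB y * partB x).
Proof. by []. Qed.

Lemma partM_lie x y : partM (lie x y) =
  (partA x *> partM y + partM x <* partB y) -
  (partA y *> partM x + partM y <* partB x).
Proof. by []. Qed.

Lemma partN_lie x y : partN (lie x y) =
  (partN x <* partA y + partB x *> partN y) -
  (partN y <* partA x + partB y *> partN x).
Proof. by []. Qed.

Definition part_lie := (partA_lie, partB_lie, partM_lie, partN_lie).

Lemma inM_inj : injective inM. Proof. by move=> m m' []. Qed.
Lemma inN_inj : injective inN. Proof. by move=> n n' []. Qed.

Lemma inMD m m' : inM (m + m') = inM m + inM m'.
Proof. by apply: gmP => /=; rewrite ?null_simp. Qed.

Lemma inND n n' : inN (n + n') = inN n + inN n'.
Proof. by apply: gmP => /=; rewrite ?null_simp. Qed.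

Lemma inNN n : inN (- n) = - inN n.
Proof. by apply: gmP => /=; rewrite ?null_simp. Qed.

Lemma gm_split x : x = diag x + inM (partM x) + inN (partN x).
Proof. by apply: gmP => /=; rewrite ?null_simp. Qed.

Lemma lie_e x : lie e x = inM (partM x) - inN (partN x).
Proof. by apply: gmP; rewrite !part_lie /= !null_simp ?subrr. Qed.

Lemma lie_eK x : x - lie e (lie e x) = diag x.
Proof.
rewrite !lie_e; apply: gmP => /=;
  by rewrite !null_simp ?opprK ?subrr.
Qed.

Lemma lie_e_inM m : lie e (inM m) = inM m.
Proof. by rewrite lie_e; apply: gmP => /=; rewrite !null_simp. Qed.

Lemma lie_e_inN n : lie e (inN n) = - inN n.
Proof. by rewrite lie_e; apply: gmP => /=; rewrite !null_simp. Qed.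

Lemma lie_e_diag x : lie e (diag x) = 0.
Proof. by rewrite lie_e; apply: gmP => /=; rewrite !null_simp. Qed.

Lemma diag_id x : lie e x = 0 -> diag x = x.
Proof. by move=> ex; rewrite -lie_eK ex lie0r subr0. Qed.

Lemma lie_e_inM_inN m n : lie e (lie (inM m) (inN n)) = 0.
Proof.
by rewrite lie_jacobi lie_e_inM lie_e_inN lieNr subrr.
Qed.

Lemma partA_inM_inN m n : partA (lie (inM m) (inN n)) = mulMN C m n.
Proof. by rewrite part_lie /= !null_simp. Qed.

Lemma partB_inM_inN m n : partB (lie (inM m) (inN n)) = - mulNM C n m.
Proof. by rewrite part_lie /= !null_simp. Qed.

Lemma inM_lact a m : inM (a *> m) = lie (inA a) (inM m).
Proof. by apply: gmP; rewrite !part_lie /= !null_simp. Qed.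

Lemma inM_ract m b : inM (m <* b) = lie (inM m) (inB b).
Proof. by apply: gmP; rewrite !part_lie /= !null_simp. Qed.

Lemma inN_lact b n : inN (b *> n) = lie (inB b) (inN n).
Proof. by apply: gmP; rewrite !part_lie /= !null_simp. Qed.

Lemma inN_ract n a : inN (n <* a) = lie (inN n) (inA a).
Proof. by apply: gmP; rewrite !part_lie /= !null_simp. Qed.

Lemma lie_e_inA a : lie e (inA a) = 0.
Proof. exact: lie_e_diag (inA a). Qed.

Lemma lie_e_inB b : lie e (inB b) = 0.
Proof. exact: lie_e_diag (inB b). Qed.

(** ** The center *)

Lemma central_diag_id z : central z -> diag z = z.
Proof. by move=> cz; apply/diag_id/lie_centralr. Qed.

(** A bracket with e has zero diagonal, a central element is diagonal. *)
Lemma central_lie_e x : central (lie e x) -> lie e x = 0.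
Proof.
move=> c; rewrite -(central_diag_id c) lie_e.
by apply: gmP => /=; rewrite ?null_simp.
Qed.

Lemma central_act z m : central z -> partA z *> m = m <* partB z.
Proof.
move=> cz; have /(congr1 (@partM _ _ _ _ _ _)) := lie_centrall (inM m) cz.
by rewrite part_lie /= !null_simp => /eqP; rewrite subr_eq0 => /eqP.
Qed.

Lemma central_mul_inM z m : central z -> z * inM m = inM (partA z *> m).
Proof.
move=> /central_diag_id <-; apply: gmP => /=; by rewrite !null_simp.
Qed.

Lemma central_mul_inN z n : central z -> z * inN n = inN (partB z *> n).
Proof.
move=> /central_diag_id <-; apply: gmP => /=; by rewrite !null_simp.
Qed.

Lemma central_actN z n : central z -> partB z *> n = n <* partA z.
Proof.
move=> cz; have /(congr1 (@partN _ _ _ _ _ _)) := lie_centrall (inN n) cz.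
by rewrite part_lie /= !null_simp => /eqP; rewrite subr_eq0 => /eqP.
Qed.

Lemma central_partA z : central z -> central (partA z).
Proof.
by move=> cz a; have /(congr1 (@partA _ _ _ _ _ _)) := cz (inA a);
  rewrite /= !null_simp.
Qed.

Lemma central_partB z : central z -> central (partB z).
Proof.
by move=> cz b; have /(congr1 (@partB _ _ _ _ _ _)) := cz (inB b);
  rewrite /= !null_simp.
Qed.

End PeirceGrading.

(** * Consequences of faithfulness *)

Section FaithfulContext.
Variables (R : comPzRingType) (A B : algType R).
Variables (M : bimodule A B) (N : bimodule B A) (C : morita_context M N).
Local Notation G := (gmatrix C).
Local Notation e := (gm_e C).
Implicit Types (a : A) (b : B) (m : M) (n : N) (x y z u v w : G).
Implicit Types (rho : G -> G) (D : G -> G -> G).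

Hypothesis tfG : two_torsion_free G.
Hypothesis faithA : left_faithful M.
Hypothesis faithB : right_faithful M.

Lemma eq_oppG x : x = - x -> x = 0.
Proof. by move=> xN; apply: tfG; rewrite mulr2n {1}xN addNr. Qed.

Lemma eq_oppM m : m = - m -> m = 0.
Proof.
move=> mN; apply: (@inM_inj _ _ _ _ _ C); apply: eq_oppG.
by rewrite {1}mN; apply: gmP => /=; rewrite ?null_simp.
Qed.

Lemma eq_oppN n : n = - n -> n = 0.
Proof.
by move=> nN; apply: (@inN_inj _ _ _ _ _ C); apply: eq_oppG; rewrite {1}nN inNN.
Qed.

(** The N-part of x is its own opposite, hence zero. *)
Lemma degreeM_id x : lie e x = x -> x = inM C (partM x).
Proof.
move=> ex; have: partN x = 0.
  apply/eq_oppN; have /(congr1 (@partN _ _ _ _ _ _)) := ex.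
  by rewrite lie_e /= add0r.
move=> n0; rewrite -[LHS]ex lie_e n0.
by apply: gmP => /=; rewrite ?null_simp.
Qed.

Lemma degreeN_id x : lie e x = - x -> x = inN C (partN x).
Proof.
move=> ex; have: partM x = 0.
  apply/eq_oppM; have /(congr1 (@partM _ _ _ _ _ _)) := ex.
  by rewrite lie_e /= oppr0 addr0.
move=> m0; rewrite -[LHS]opprK -[X in - X]ex lie_e m0.
by apply: gmP => /=; rewrite ?null_simp ?opprK.
Qed.

(** Faithfulness makes a and b central: a a' and a' a both act on m as
    a' followed by b on the right. *)
Lemma central_GMatrix a b : (forall m, a *> m = m <* b) ->
  (forall n, b *> n = n <* a) -> central (GMatrix C a 0 0 b).
Proof.
move=> abM abN.
have ca a' : a * a' = a' * a.
  apply/eqP; rewrite -subr_eq0; apply/eqP/faithA => m.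
  apply: (addIr ((a' * a) *> m)).
  by rewrite -lactDl subrK add0r -!lactA !abM lractA.
have cb b' : b * b' = b' * b.
  apply/eqP; rewrite -subr_eq0; apply/eqP/faithB => m.
  apply: (addIr (m <* (b' * b))).
  by rewrite -ractDr subrK add0r -!ractA -!abM lractA.
by move=> y; apply: gmP; rewrite /= ?null_simp //.
Qed.

Lemma central_degree0 x : lie e x = 0 ->
  (forall m, lie x (inM C m) = 0) -> (forall n, lie x (inN C n) = 0) ->
  central x.
Proof.
move=> /diag_id xd xM xN; rewrite -xd; apply: central_GMatrix => [m|n].
  have /(congr1 (@partM _ _ _ _ _ _)) := xM m.
  by rewrite part_lie /= ?null_simp => /eqP; rewrite subr_eq0 => /eqP.
have /(congr1 (@partN _ _ _ _ _ _)) := xN n.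
by rewrite part_lie /= ?null_simp => /eqP; rewrite subr_eq0 => /eqP.
Qed.

Lemma central_eq0 z : central z ->
  (forall m, z * inM C m = 0) -> z = 0.
Proof.
move=> cz zM.
have zA : partA z = 0.
  apply: faithA => m; apply: (@inM_inj _ _ _ _ _ C).
  by rewrite -central_mul_inM ?zM.
have zB : partB z = 0.
  by apply: faithB => m; rewrite -(central_act _ cz) zA lact0l.
by rewrite -(central_diag_id cz) /diag zA zB.
Qed.

Lemma central_eq0_degree z : central z ->
  (forall x, central (z * lie e x)) -> z = 0.
Proof.
move=> cz zc; apply: central_eq0 => // m.
have := zc (inM C m); rewrite -lieMr // => /central_lie_e.
by rewrite lieMr // lie_e_inM.
Qed.

(** Apply rho to m = [e, m] and compare M-parts: rho m occurs on both sides,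
    and the diagonal part of rho e must commute with m.  Likewise on N. *)
Lemma lie_der_diag rho : lie_derivation rho -> central (diag (rho e)).
Proof.
move=> rd; apply: central_GMatrix => [m|n].
  have := lie_derL rd e (inM C m); rewrite lie_e_inM.
  move/(congr1 (@partM _ _ _ _ _ _)); rewrite lie_e /= ?null_simp.
  by move/eqP; rewrite -subr_eq subrr eq_sym subr_eq0 => /eqP.
have := lie_derL rd e (inN C n); rewrite lie_e_inN (lie_derN rd).
move/(congr1 (@partN _ _ _ _ _ _)); rewrite lie_e /= ?null_simp.
by move/eqP; rewrite -subr_eq subrr eq_sym subr_eq0 => /eqP.
Qed.

Lemma lie_der_ade rho x : lie_derivation rho -> central (rho e) ->
  rho (lie e x) = lie e (rho x).
Proof. by move=> rd ce; rewrite (lie_derL rd) (lie_centrall _ ce) add0r. Qed.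

Section Ideals.
Hypothesis no_ideal : no_nonzero_central_ideal A \/ no_nonzero_central_ideal B.

(** This is how the absence of central ideals is used: the elements a' with
    A a' inside the center of A form a central ideal, which contains the A-part
    of z.  The same works in B, on the other side.
    Once one part of z vanishes, so does the other, by faithfulness. *)
Lemma central_part_ideal_eq0 z : central z ->
  (forall a, exists2 z' : G, central z' & partA z' = a * partA z) ->
  (forall b, exists2 z' : G, central z' & partB z' = partB z * b) -> z = 0.
Proof.
move=> cz idA idB; suff: partA z = 0 \/ partB z = 0.
  move=> zAB; apply: central_eq0 => // m; rewrite central_mul_inM //.
  case: zAB => z0; first by rewrite z0 lact0l.
  by rewrite central_act // z0 ract0r.
case: no_ideal => no0; [left|right].
  apply: (no0 (fun a' => forall a, central (a * a'))) => [|a]; last first.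
    by have [z' cz' <-] := idA a; apply: central_partA.
  split=> [|x cx]; last by rewrite -[x]mul1r; apply: cx.
  split=> [a|x y cx cy a|a x cx a'|a x cx a'].
  - by rewrite mulr0; apply: central0.
  - by rewrite mulrDr; apply: centralD.
  - by rewrite mulrA; apply: cx.
  - by have := cx 1; rewrite mul1r => ->; rewrite mulrA; apply: cx.
apply: (no0 (fun b' => forall b, central (b' * b))) => [|b]; last first.
  by have [z' cz' <-] := idB b; apply: central_partB.
split=> [|x cx]; last by rewrite -[x]mulr1; apply: cx.
split=> [b|x y cx cy b|b x cx b'|b x cx b'].
- by rewrite mul0r; apply: central0.
- by rewrite mulrDl; apply: centralD.
- by have := cx 1; rewrite mulr1 => <-; rewrite -mulrA; apply: cx.
- by rewrite -mulrA; apply: cx.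
Qed.

(** Put c = D(e, e), with off-diagonal parts p and q.  The diagonal part of
    D(m, e) is central because D(m, -) is a Lie derivation, and equals the one
    of [c, m] because D(-, e) is one.  Thus all [m, q] are central, and their
    parts generate central ideals; so M q = q M = 0, and N p = p N = 0 in the
    same way.  The interchange relation at (e, e) makes c commute with
    commutators of diagonal elements, and the products just killed account for
    the difference with arbitrary commutators. *)
Lemma extremal_ee D : lie_biderivation D ->
  forall u v, lie (lie u v) (inM C (partM (D e e))) = 0 /\
              lie (lie u v) (inN C (partN (D e e))) = 0.
Proof.
move=> [D1 D2]; set c := D e e; set p := partM c; set q := partN c.
have De y : central (diag (D y e)) by apply: lie_der_diag (D2 y).
have diagD y : diag (D (lie e y) e) = diag (lie c y).
  rewrite (lie_derL (D1 e)) lie_e.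
  by apply: gmP => /=; rewrite ?null_simp.
have q0 m : lie (inM C m) (inN C q) = 0.
  have diagM m' : diag (lie c (inM C m')) = - lie (inM C m') (inN C q).
    by apply: gmP; rewrite /= ?part_lie /= ?null_simp ?opprK.
  have cM m' : central (lie (inM C m') (inN C q)).
    rewrite -[lie _ _]opprK -diagM -diagD lie_e_inM.
    exact/centralN.
  apply: central_part_ideal_eq0 => // [a|b].
    exists (lie (inM C (a *> m)) (inN C q)) => //.
    by rewrite !partA_inM_inN mulMN_lact.
  exists (lie (inM C (m <* b)) (inN C q)); rewrite // !partB_inM_inN.
  by rewrite mulNM_ract mulNr.
have p0 n : lie (inM C p) (inN C n) = 0.
  have diagN n' : diag (lie c (inN C n')) = lie (inM C p) (inN C n').
    by apply: gmP; rewrite /= ?part_lie /= ?null_simp.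
  have cN n' : central (lie (inM C p) (inN C n')).
    by rewrite -diagN -diagD.
  apply: central_part_ideal_eq0 => // [a|b].
    exists (lie (inM C p) (inN C (n <* a))); first exact: cN.
    by rewrite -(central_partA (cN n)) !partA_inM_inN mulMN_ract.
  exists (lie (inM C p) (inN C (b *> n))); first exact: cN.
  by rewrite (central_partB (cN n)) !partB_inM_inN mulNM_lact mulrN.
have pn n : mulMN C p n = 0 by rewrite -partA_inM_inN p0.
have np n : mulNM C n p = 0 by apply: oppr_inj; rewrite -partB_inM_inN p0 oppr0.
have mq m : mulMN C m q = 0 by rewrite -partA_inM_inN q0.
have qm m : mulNM C q m = 0 by apply: oppr_inj; rewrite -partB_inM_inN q0 oppr0.
have cuv u v : lie c (lie (diag u) (diag v)) = 0.
  have := biderivation_interchange e e (diag u) (diag v) (conj D1 D2).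
  by rewrite liexx [lie (diag u) e]lieC !lie_e_diag oppr0 !lie0r !addr0.
move=> u v; split; apply: gmP; rewrite !part_lie /= !null_simp //.
- by rewrite pn oppr0.
- have /(congr1 (@partM _ _ _ _ _ _)) := cuv u v.
  rewrite !part_lie /= !null_simp => /eqP; rewrite subr_eq0 => /eqP eq_p.
  rewrite !(lactBl, lactDl, ractBr, ractDr) !mulMNM !np !ract0r.
  rewrite -!mulMNM !pn !null_simp.
  by rewrite -lactBl -ractBr eq_p subrr.
- have /(congr1 (@partN _ _ _ _ _ _)) := cuv u v.
  rewrite !part_lie /= !null_simp => /eqP; rewrite subr_eq0 => /eqP eq_q.
  rewrite !(lactBl, lactDl, ractBr, ractDr) !mulNMN !mq !ract0r.
  rewrite -!mulNMN !qm !null_simp.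
  by rewrite -lactBl -ractBr eq_q subrr.
- by rewrite qm oppr0.
Qed.


(** ** Special pairs and Lie derivations *)

Hypothesis centerA : forall a,
  (exists2 z : G, central z & partA z = a) <-> central a.
Hypothesis centerB : forall b,
  (exists2 z : G, central z & partB z = b) <-> central b.
Hypothesis special_standard : forall (F : M -> M) (E : N -> N),
  special_pair C F E -> standard_form F E.

(** By the hypothesis on the centers, w0 and w1 are parts of central elements
    z0 and z1 of the whole algebra, and z0 + z1 induces both maps. *)
Lemma special_pair_scalar F E : special_pair C F E ->
  exists2 alpha : G, central alpha &
    (forall m, inM C (F m) = alpha * inM C m) /\
    (forall n, inN C (E n) = - (alpha * inN C n)).
Proof.
move=> /special_standard [_ [_ [/centerA[z0 c0 <-] /centerB[z1 c1 <-] FE EE]]].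
have c01 := centralD c0 c1; exists (z0 + z1) => //; split=> [m|n].
  by rewrite central_mul_inM // FE -(central_act m c1) -lactDl.
by rewrite central_mul_inN // EE -(central_actN n c0) -opprD -lactDl inNN.
Qed.

(** Since rho kills the diagonal modulo the center, its restrictions F and E to
    M and N are bimodule homomorphisms.  The elements rho [m, n] are central and
    their parts F(m)n + mE(n), nF(m) + E(n)m behave like an ideal, so they
    vanish: (F, E) is a special pair. *)
Lemma lie_der_scalar rho : lie_derivation rho -> central (rho e) ->
  (forall x, lie e x = 0 -> central (rho x)) ->
  exists2 alpha : G, central alpha &
    forall x, central (rho x - alpha * lie e x).
Proof.
move=> rd ce c0; pose F m := partM (rho (inM C m)).
pose E n := partN (rho (inN C n)).
have rhoM m : rho (inM C m) = inM C (F m).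
  by apply: degreeM_id; rewrite -lie_der_ade // lie_e_inM.
have rhoN n : rho (inN C n) = inN C (E n).
  by apply: degreeN_id; rewrite -lie_der_ade // lie_e_inN lie_derN.
have rhoA a : central (rho (inA C a)) by apply/c0/lie_e_inA.
have rhoB b : central (rho (inB C b)) by apply/c0/lie_e_inB.
have FA a m : F (a *> m) = a *> F m.
  apply: (@inM_inj _ _ _ _ _ C); rewrite -rhoM !inM_lact (lie_derL rd) rhoM.
  by rewrite lie_centrall // add0r.
have FB m b : F (m <* b) = F m <* b.
  apply: (@inM_inj _ _ _ _ _ C); rewrite -rhoM !inM_ract (lie_derL rd) rhoM.
  by rewrite (lie_centralr _ (rhoB b)) addr0.
have EB b n : E (b *> n) = b *> E n.
  apply: (@inN_inj _ _ _ _ _ C); rewrite -rhoN !inN_lact (lie_derL rd) rhoN.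
  by rewrite lie_centrall // add0r.
have EA n a : E (n <* a) = E n <* a.
  apply: (@inN_inj _ _ _ _ _ C); rewrite -rhoN !inN_ract (lie_derL rd) rhoN.
  by rewrite (lie_centralr _ (rhoA a)) addr0.
have FD : {morph F : m m' / m + m'}.
  move=> m m'; apply: (@inM_inj _ _ _ _ _ C).
  by rewrite -rhoM !inMD (lie_derD rd) !rhoM.
have ED : {morph E : n n' / n + n'}.
  move=> n n'; apply: (@inN_inj _ _ _ _ _ C).
  by rewrite -rhoN !inND (lie_derD rd) !rhoN.
pose z m n := rho (lie (inM C m) (inN C n)).
have cz m n : central (z m n) by apply/c0/lie_e_inM_inN.
have zA m n : partA (z m n) = mulMN C (F m) n + mulMN C m (E n).
  by rewrite /z (lie_derL rd) rhoM rhoN /= !null_simp.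
have zB m n : partB (z m n) = - (mulNM C n (F m) + mulNM C (E n) m).
  by rewrite /z (lie_derL rd) rhoM rhoN /= !null_simp -opprD.
have z0 m n : z m n = 0.
  apply: central_part_ideal_eq0 => // [a|b].
    by exists (z (a *> m) n) => //; rewrite !zA FA !mulMN_lact mulrDr.
  exists (z (m <* b) n) => //.
  by rewrite !zB FB !mulNM_ract -mulrDl mulNr.
have spFE : special_pair C F E.
  split=> [||m n|n m]; [by split|by split|by rewrite -zA z0|].
  by apply: oppr_inj; rewrite -zB z0 oppr0.
have [alpha ca [alphaF alphaE]] := special_pair_scalar spFE.
exists alpha => // x.
rewrite {1}(gm_split x) !(lie_derD rd) rhoM rhoN alphaF alphaE lie_e.
rewrite -(addrA (rho _)) -mulrBr addrK; apply: c0.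
exact: lie_e_diag.
Qed.

(** ** Regularity of central elements *)

Hypothesis central_regular : forall alpha x : G,
  central alpha -> x <> 0 -> alpha * x = 0 -> alpha = 0.
Hypothesis noncommutative : MN_zero C /\ NM_zero C ->
  ~ commutative_ring A \/ ~ commutative_ring B.

Lemma central_mul_eq0 alpha x :
  central alpha -> alpha * x = 0 -> alpha = 0 \/ x = 0.
Proof.
move=> ca ax; have [->|/eqP xn0] := eqVneq x 0; [by right | left].
exact: central_regular ax.
Qed.

(** If alpha is nonzero, it is a non-zero-divisor and all these commutators
    vanish: MN = NM = 0 and, by faithfulness, both A and B are commutative. *)
Lemma central_commutator_eq0 alpha : central alpha ->
  (forall m n, alpha * lie (inM C m) (inN C n) = 0) ->
  (forall m u v, lie e u = 0 -> lie e v = 0 ->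
     alpha * lie (inM C m) (lie u v) = 0) -> alpha = 0.
Proof.
move=> ca alphaMN alphaM.
have [//|/eqP an0] := eqVneq alpha 0.
have regular x : alpha * x = 0 -> x = 0.
  by move=> ax; case: (central_mul_eq0 ca ax).
have MN m n : lie (inM C m) (inN C n) = 0 by apply/regular.
have Muv m u v : lie e u = 0 -> lie e v = 0 -> lie (inM C m) (lie u v) = 0.
  by move=> eu ev; apply/regular/alphaM.
exfalso; case: noncommutative => [|ncA|ncB].
- split=> [m n|n m]; first by rewrite -partA_inM_inN MN.
  by apply: oppr_inj; rewrite -partB_inM_inN MN oppr0.
- apply: ncA => a a'; apply/eqP; rewrite -subr_eq0; apply/eqP/faithA => m.
  have /(congr1 (@partM _ _ _ _ _ _)) :=
    Muv m _ _ (lie_e_inA C a) (lie_e_inA C a').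
  by rewrite part_lie /= !null_simp => /eqP; rewrite oppr_eq0 => /eqP.
- apply: ncB => b b'; apply/eqP; rewrite -subr_eq0; apply/eqP/faithB => m.
  have /(congr1 (@partM _ _ _ _ _ _)) :=
    Muv m _ _ (lie_e_inB C b) (lie_e_inB C b').
  by rewrite part_lie /= !null_simp.
Qed.

(** * Lie biderivations and triderivations modulo the center *)

(** Each partial map is a scalar, alpha on the left and beta on the right.  The
    interchange relation at (e, e, n, m) gives (alpha + beta)[m, n] = 0, and two
    instances of it for u, v diagonal compute [D(u, v), m] both as
    - beta [m, [u, v]] and as alpha [m, [u, v]]. *)
Lemma biderivation_scalar D : lie_biderivation D -> central (D e e) ->
  exists2 alpha : G, central alpha &
    forall x, central (D x e - alpha * lie e x) /\
              central (D e x + alpha * lie e x).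
Proof.
move=> bD ce; have [D1 D2] := bD.
have c1 x : lie e x = 0 -> central (D x e).
  move=> ex; rewrite -(@diag_id _ _ _ _ _ _ (D x e)).
    exact: lie_der_diag (D2 x).
  by rewrite -(lie_der_ade x (D1 e) ce) /= ex (lie_der0 (D1 e)).
have c2 x : lie e x = 0 -> central (D e x).
  move=> ex; rewrite -(@diag_id _ _ _ _ _ _ (D e x)).
    exact: lie_der_diag (D1 x).
  by rewrite -(lie_der_ade x (D2 e) ce) ex (lie_der0 (D2 e)).
have [alpha ca alphaD] := lie_der_scalar (D1 e) ce c1.
have [beta cb betaD] := lie_der_scalar (D2 e) ce c2.
exists alpha => // x; split; first exact: alphaD.
suff ab0 : alpha + beta = 0.
  by rewrite -[alpha]opprK (addr0_eq ab0) mulNr; apply: betaD.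
have DeM m y : lie (D e (inM C m)) y = beta * lie (inM C m) y.
  by rewrite (lie_eql _ (betaD _)) lie_e_inM lieMl.
apply: central_commutator_eq0 => [|m n|m u v eu ev]; first exact: centralD.
  have := biderivation_interchange e e (inN C n) (inM C m) bD.
  rewrite (lie_centrall _ ce) liexx lie0r addr0 lie_e_inM.
  rewrite [lie _ e]lieC lie_e_inN opprK DeM (lie_eql _ (alphaD _)) lie_e_inN.
  by rewrite lieMl // lieNl -lieC -mulrDl addrC.
have := biderivation_interchange e v u (inM C m) bD.
rewrite (lie_centrall _ (c2 _ ev)) ev lie0r addr0 lie_e_inM DeM => Duv.
have := biderivation_interchange u e (inM C m) v bD.
rewrite (lie_centrall _ (c1 _ eu)) [lie u e]lieC eu oppr0 lie0r addr0.
rewrite [lie _ e]lieC lie_e_inM lieNr (lie_eql _ (alphaD _)) lie_e_inM lieMl //.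
move=> /eqP; rewrite eq_sym addrC subr_eq0 => /eqP Dm.
by rewrite mulrDl Dm addrC -Duv.
Qed.

(** ** Three arguments *)

Definition lie_triderivation (T : G -> G -> G -> G) : Prop :=
  [/\ forall y z, lie_derivation (fun x => T x y z),
      forall x z, lie_derivation (fun y => T x y z)
    & forall x y, lie_derivation (fun z => T x y z)].

Lemma triderivation_bi12 T z :
  lie_triderivation T -> lie_biderivation (fun x y => T x y z).
Proof. by case=> T1 T2 T3; split=> [y|x]; [apply: T1 | apply: T2]. Qed.

Lemma triderivation_bi13 T y :
  lie_triderivation T -> lie_biderivation (fun x z => T x y z).
Proof. by case=> T1 T2 T3; split=> [z|x]; [apply: T1 | apply: T3]. Qed.

Lemma triderivation_bi23 T x : lie_triderivation T -> lie_biderivation (T x).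
Proof. by case=> T1 T2 T3; split=> [z|y]; [apply: T2 | apply: T3]. Qed.

(** Let a, b, c be the scalars of the three pairs of places.  Comparing the
    three families T(x,e,e), T(e,x,e), T(e,e,x) gives a = b, a = - c and b = c,
    so 2 a = 0. *)
Lemma triderivation_central_ee T : lie_triderivation T ->
  central (T e e e) -> forall x, central (T x e e).
Proof.
move=> tT ce.
have [a ca aT] := biderivation_scalar (triderivation_bi12 e tT) ce.
have [b cb bT] := biderivation_scalar (triderivation_bi13 e tT) ce.
have [c cc cT] := biderivation_scalar (triderivation_bi23 e tT) ce.
have ab : a = b.
  apply/eqP; rewrite -subr_eq0; apply/eqP/central_eq0_degree => [|x].
    exact: centralB.
  have := centralB (bT x).1 (aT x).1.
  by rewrite mulrBl opprB addrC subrKA.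
have bc : b = c.
  apply/eqP; rewrite -subr_eq0; apply/eqP/central_eq0_degree => [|x].
    exact: centralB.
  have := centralB (bT x).2 (cT x).2.
  by rewrite mulrBl opprD addrACA subrr add0r.
have ac : a + c = 0.
  apply/central_eq0_degree => [|x]; first exact: centralD.
  have := centralB (aT x).2 (cT x).1.
  by rewrite mulrDl opprB addrCA addrAC subrr add0r addrC.
have a0 : a = 0.
  by apply: eq_oppG; apply/eqP; rewrite -addr_eq0 {2}ab bc ac.
by move=> x; have := (aT x).1; rewrite a0 mul0r subr0.
Qed.

(** Let a_z be the scalar of T(-, -, z).  Moving e through the three places
    yields T(e, z, x) = a_z [e, x], whereas T(e, x, z) = - a_z [e, x], modulo
    the center.  For x = z both hold, so 2 a_z [e, z] = 0; exchanging the roles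
    of x and z also settles the case [e, z] = 0. *)
Lemma triderivation_central_e T : lie_triderivation T ->
  (forall x, central (T x e e)) -> (forall x, central (T e x e)) ->
  (forall x, central (T e e x)) -> forall x z, central (T x e z).
Proof.
move=> tT T1 T2 T3.
have scalar z : exists2 alpha : G, central alpha & forall x,
    [/\ central (T x e z - alpha * lie e x),
        central (T e x z + alpha * lie e x)
      & central (T e z x - alpha * lie e x)].
  have [a ca aT] := biderivation_scalar (triderivation_bi12 z tT) (T3 z).
  have [c cc cT] := biderivation_scalar (triderivation_bi13 z tT) (T2 z).
  exists a => // x; have [aT1 aT2] := aT x; have [cT1 cT2] := cT x.
  suff ac : a + c = 0 by split=> //; rewrite -mulNr (addr0_eq ac).
  apply/central_eq0_degree => [|y]; first exact: centralD.
  have [b cb bT] := biderivation_scalar (triderivation_bi23 y tT) (T1 y).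
  have [bT1 bT2] := bT z.
  have := centralB (centralD bT1 bT2) (centralD (cT y).1 (aT y).1).
  (* The contributions of b cancel, which leaves (a + c) [e, y]. *)
  rewrite [T y e z + _]addrC subrKA [X in _ - X]addrACA -opprD opprB.
  by rewrite addrCA subrr addr0 -mulrDl [c + a]addrC.
move=> x z; have [a ca aT] := scalar z.
have a_ez : a * lie e z = 0.
  have [_ ezz ezz'] := aT z.
  apply: tfG; rewrite mulr2n -lieMr // -lieDr; apply: central_lie_e.
  rewrite lieDr lieMr //; have := centralB ezz ezz'.
  by rewrite opprB addrC subrKA.
suff a0 : a = 0 by have [+ _ _] := aT x; rewrite a0 mul0r subr0.
case: (central_mul_eq0 ca a_ez) => // ez0.
apply: central_eq0_degree => // y.
have [b cb bT] := scalar y; have [_ bTz _] := bT z; have [_ _ aTy] := aT y.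
by have := centralB bTz aTy; rewrite ez0 mulr0 addr0 opprB addrC subrK.
Qed.

(** D commutes with [e, -] in each argument, so D(x, y) vanishes when x and y
    are homogeneous of different degrees.  On diagonal arguments the interchange
    relation applies.  For y fixed, D(-, y) is a scalar alpha modulo the center:
    it is zero because D(m, y) = 0, unless y lies in M, in which case
    alpha annihilates the commutators of [central_commutator_eq0]. *)
Lemma biderivation_central D : lie_biderivation D ->
  (forall x, central (D x e)) -> (forall x, central (D e x)) ->
  forall x y, central (D x y).
Proof.
move=> bD cDe ceD; have [D1 D2] := bD.
have Dl x y : D (lie e x) y = lie e (D x y).
  exact: lie_der_ade (D1 y) (ceD y).
have Dr x y : D x (lie e y) = lie e (D x y).
  exact: lie_der_ade (D2 x) (cDe x).
have D00 u v : lie e u = 0 -> lie e v = 0 -> central (D u v).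
  move=> eu ev; apply: central_degree0 => [|m|n].
  - by rewrite -Dl eu (lie_der0 (D1 v)).
  - have := biderivation_interchange e v u (inM C m) bD.
    rewrite (lie_centrall _ (ceD v)) ev lie0r addr0 (lie_centrall _ (ceD _)).
    by rewrite add0r lie_e_inM.
  - have := biderivation_interchange e v u (inN C n) bD.
    rewrite (lie_centrall _ (ceD v)) ev lie0r addr0 (lie_centrall _ (ceD _)).
    by rewrite add0r lie_e_inN lieNr => /eqP; rewrite eq_sym oppr_eq0 => /eqP.
have D0M u m : lie e u = 0 -> D u (inM C m) = 0.
  by move=> eu; rewrite -lie_e_inM Dr -Dl eu (lie_der0 (D1 _)).
have DM0 m u : lie e u = 0 -> D (inM C m) u = 0.
  by move=> eu; rewrite -lie_e_inM Dl -Dr eu (lie_der0 (D2 _)).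
have D0N u n : lie e u = 0 -> D u (inN C n) = 0.
  move=> eu; apply: oppr_inj; rewrite oppr0 -(lie_derN (D2 u)) -lie_e_inN Dr.
  by rewrite -Dl eu (lie_der0 (D1 _)).
have DMN m n : D (inM C m) (inN C n) = 0.
  apply: eq_oppG; rewrite -{1}lie_e_inM Dl -Dr lie_e_inN.
  by rewrite (lie_derN (D2 _)).
have DNM m n : D (inN C n) (inM C m) = 0.
  apply: eq_oppG; rewrite -{1}lie_e_inM Dr -Dl lie_e_inN.
  by rewrite (lie_derN (D1 _)).
have scalar y : (forall u, lie e u = 0 -> central (D u y)) ->
    exists2 alpha : G, central alpha &
      forall x, central (D x y - alpha * lie e x).
  exact: lie_der_scalar (D1 y) (ceD y).
have kill y : (forall u, lie e u = 0 -> central (D u y)) ->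
    (forall m, D (inM C m) y = 0) -> forall x, central (D x y).
  move=> c0 D0 x; have [alpha ca alphaD] := scalar y c0.
  suff a0 : alpha = 0 by have := alphaD x; rewrite a0 mul0r subr0.
  apply: central_eq0 => // m; have := alphaD (inM C m).
  rewrite D0 sub0r -mulrN -lieNr -lieMr // => /central_lie_e.
  by rewrite lieMr // lieNr lie_e_inM mulrN => /eqP; rewrite oppr_eq0 => /eqP.
move=> x y; rewrite (gm_split y) !(lie_derD (D2 x)).
have ed := lie_e_diag y.
apply: centralD; [apply: centralD|].
- by apply: kill => [u eu|m]; [apply: D00 | apply: DM0].
- set m' := partM y; have [|alpha ca alphaD] := scalar (inM C m').
    by move=> u eu; rewrite D0M //; apply: central0.
  suff a0 : alpha = 0 by have := alphaD x; rewrite a0 mul0r subr0.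
  have DMM m w : lie (D (inM C m) (inM C m')) w = alpha * lie (inM C m) w.
    by rewrite (lie_eql _ (alphaD _)) lie_e_inM lieMl.
  apply: central_commutator_eq0 => // [m n|m u v eu ev].
    have := lie_derL (D1 (inM C m')) (inM C m) (inN C n).
    by rewrite /= DMM DNM lie0r addr0 D0M ?lie_e_inM_inN.
  have := biderivation_interchange (inM C m) (inM C m') u v bD.
  rewrite DMM DM0 // D0M // ![lie 0 _]lieC !lie0r !oppr0 addr0.
  suff -> : lie (inM C m) (inM C m') = 0 by rewrite lie0r addr0.
  by apply: gmP; rewrite part_lie /= !null_simp.
- apply: kill => [u eu|m]; last exact: DMN.
  by rewrite D0N //; apply: central0.
Qed.

(** * Eliminating the idempotent from the arguments *)

Section Multi.
Variables (p : nat) (psi : {ffun 'I_p -> G} -> G).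
Hypothesis p3 : (3 <= p)%N.
Hypothesis psi_der : n_lie_derivation psi.
Hypothesis psi_e : central (psi [ffun=> e]).
Implicit Types (t : {ffun 'I_p -> G}) (i j l : 'I_p) (S : {set 'I_p}).

(** Places are bounded by a set containing them rather than counted, since such
    a set is easily updated when an argument is replaced. *)
Definition e_off S t : Prop := forall i, i \notin S -> t i = e.

Definition central_up_to k : Prop :=
  forall t S, (#|S| <= k)%N -> e_off S t -> central (psi t).

Lemma exists_notin S : (#|S| < p)%N -> exists j, j \notin S.
Proof.
move=> Sp; have /card_gt0P[j] : (0 < #|~: S|)%N.
  by rewrite cardsCs setCK card_ord subn_gt0.
by rewrite inE => jS; exists j.
Qed.

Lemma n_lie_trider t i j l : i != j -> i != l -> j != l -> lie_triderivation
  (fun x y z => psi (subst_arg (subst_arg (subst_arg t i x) j y) l z)).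
Proof.
move=> ij il jl; split=> [y z|x z|x y].
- have [D1 _] := n_lie_bider (subst_arg t l z) psi_der ij; have [L1 L2] := D1 y.
  by split=> [k x x'|x x'] /=; rewrite !(subst_argC _ _ _ jl)
    !(subst_argC _ _ _ il); [apply: L1 | apply: L2].
- by have [D1 _] := n_lie_bider (subst_arg t i x) psi_der jl; apply: D1.
- exact: psi_der.2.
Qed.

Lemma central_up_to1 : central_up_to 1.
Proof.
move=> t S; rewrite leq_eqVlt ltnS leqn0.
case/orP=> [/cards1P[i ->]|/eqP/cards0_eq->] te; last first.
  suff -> : t = [ffun=> e] by [].
  by apply/ffunP => i; rewrite ffunE te // inE.
have [|j] := @exists_notin [set i]; first by rewrite cards1 ltnW.
rewrite inE eq_sym => ij; have [|l] := @exists_notin [set i; j].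
  by rewrite cards2 ij.
rewrite !inE negb_or ![l == _]eq_sym => /andP[il jl].
have te_l : t l = e by apply: te; rewrite inE eq_sym.
have te_j : t j = e by apply: te; rewrite inE eq_sym.
have <- : subst_arg (subst_arg (subst_arg t i (t i)) j e) l e = t.
  by rewrite !subst_arg_id.
apply: (triderivation_central_ee (n_lie_trider t ij il jl)).
suff -> : subst_arg (subst_arg (subst_arg t i e) j e) l e = [ffun=> e] by [].
apply/ffunP => h; rewrite !ffunE; case: eqP => // _; case: eqP => // _.
by case: eqP => // /eqP hi; apply: te; rewrite inE.
Qed.

(** Two arguments i, l outside e and one argument j equal to e make a Lie
    triderivation whose values with two e's are covered by the induction
    hypothesis.  The place j must exist, which is why one e always remains. *)
Lemma central_up_toS k :
  (k.+2 < p)%N -> central_up_to k.+1 -> central_up_to k.+2.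
Proof.
move=> kp IH t S; rewrite leq_eqVlt ltnS => /orP[/eqP cS|]; last exact: IH.
move=> te; have [|j jS] := @exists_notin S; first by rewrite cS.
have /card_gt1P[i [l [iS lS il]]] : (1 < #|S|)%N by rewrite cS.
have ij : i != j by apply: contraNneq jS => <-.
have jl : j != l by apply: contraNneq jS => ->.
have cD h (hS : h \in S) : (#|S :\ h| <= k.+1)%N.
  by move: cS; rewrite (cardsD1 h) hS add1n => -[->].
have <- : subst_arg (subst_arg (subst_arg t i (t i)) j e) l (t l) = t.
  by rewrite (subst_arg_id (erefl (t i))) (subst_arg_id (te j jS)) subst_arg_id.
apply: (triderivation_central_e (n_lie_trider t ij il jl)) => x /=.
- apply: (IH _ (S :\ l)); first exact: cD.
  move=> h; rewrite !ffunE !inE negb_and negbK.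
  case: eqP => //= _; case: eqP => // _; case: eqP => [->|_]; last exact: te.
  by rewrite iS.
- apply: (IH _ (j |: (S :\ i :\ l))).
    have iSl : i \in S :\ l by rewrite !inE il iS.
    rewrite cardsU1 (leq_trans (leq_add (leq_b1 _) (leqnn _))) // add1n.
    by have := cD _ lS; rewrite (cardsD1 i) iSl add1n setDDl setUC -setDDl.
  move=> h; rewrite !ffunE !inE !negb_or !negb_and !negbK.
  case: eqP => //= _; case: eqP => //= _; case: eqP => //= _.
  exact: te.
- apply: (IH _ (S :\ i)); first exact: cD.
  move=> h; rewrite !ffunE !inE negb_and negbK.
  case: eqP => [->|_] /=; first by rewrite (negPf il) (negPf ij).
  by move=> hS; rewrite te // if_same; case: eqP hS => // ->; rewrite lS.
Qed.

Lemma central_up_to_pred : central_up_to p.-1.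
Proof.
suff: forall k, (k.+1 < p)%N -> central_up_to k.+1.
  by case: p p3 => [|[|k]] // _; apply.
by elim=> [_|k IH kp]; [apply: central_up_to1 | apply/central_up_toS/IH/ltnW].
Qed.

Lemma n_lie_derivation_central t : central (psi t).
Proof.
have p2 := ltnW p3; pose i : 'I_p := Ordinal (ltnW p2).
pose j : 'I_p := Ordinal p2.
have ij : i != j by [].
have cC (h : 'I_p) : (#|[set~ h]| <= p.-1)%N by rewrite cardsC1 card_ord.
rewrite -(subst_arg_id (erefl (t i))).
rewrite -(subst_arg_id (erefl (subst_arg t i (t i) j))).
apply: (biderivation_central (n_lie_bider t psi_der ij)) => x /=.
  by apply: (central_up_to_pred (cC j)) => h; rewrite !inE negbK ffunE => ->.
apply: (central_up_to_pred (cC i)) => h; rewrite !inE negbK !ffunE => /eqP->.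
by rewrite (negPf ij) eqxx.
Qed.

End Multi.
End Ideals.
End FaithfulContext.

(** * The extremal part *)

Section CornerElement.
Variables (R : comPzRingType) (A B : algType R).
Variables (M : bimodule A B) (N : bimodule B A) (C : morita_context M N).
Local Notation G := (gmatrix C).
Local Notation e := (gm_e C).
Local Notation f := (gm_f C).

Lemma corner_ef (x : G) : e * x * f = inM C (partM x).
Proof. by apply: gmP; rewrite /= !null_simp. Qed.

Lemma corner_fe (x : G) : f * x * e = inN C (partN x).
Proof. by apply: gmP; rewrite /= !null_simp. Qed.

Lemma central_sign k : central ((-1) ^+ k : G).
Proof. by move=> x; rewrite commr_sign. Qed.

(** The sign by which X0 has to be twisted on N. *)
Lemma iter_lie_e k (x : G) (y : G) : lie e x = x -> lie e y = - y ->
  iter k (lie e) (x + y) = x + (-1) ^+ k * y.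
Proof.
move=> ex ey; elim: k => [|k IH]; first by rewrite expr0 mul1r.
rewrite iterS IH lieDr ex lieMr ?ey; last exact: central_sign.
by rewrite exprS mulN1r mulrN mulNr.
Qed.

End CornerElement.

Theorem theoremA (R : comPzRingType) (A B : algType R)
    (M : bimodule A B) (N : bimodule B A) (C : morita_context M N)
    (n : nat) (phi : {ffun 'I_n -> gmatrix C} -> gmatrix C)
    (e := gm_e C) (f := gm_f C) (phie := phi [ffun=> e])
    (X0 := e * phie * f + (-1) ^+ n * (f * phie * e)) :
  two_torsion_free R ->
  two_torsion_free (gmatrix C) ->
  nonzero_module M \/ nonzero_module N ->
  left_faithful M -> right_faithful M ->
  (3 <= n)%N ->
  n_lie_derivation phi ->
  (* (1) *)
  (forall a : A, (exists2 z : gmatrix C, central z & partA z = a) <-> central a) ->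
  (forall b : B, (exists2 z : gmatrix C, central z & partB z = b) <-> central b) ->
  (* (2) *)
  no_nonzero_central_ideal A \/ no_nonzero_central_ideal B ->
  (* (3) *)
  (forall alpha a : gmatrix C,
     central alpha -> a <> 0 -> alpha * a = 0 -> alpha = 0) ->
  (* (4) *)
  (MN_zero C /\ NM_zero C -> ~ commutative_ring A \/ ~ commutative_ring B) ->
  (* (5) *)
  (forall (F : M -> M) (E : N -> N), special_pair C F E -> standard_form F E) ->
  exists kappa psi : {ffun 'I_n -> gmatrix C} -> gmatrix C,
    [/\ forall x, phi x = kappa x + psi x,
        extremal_at X0 kappa,
        nlinear psi,
        forall x, central (psi x)
      & vanishes_on_commutators psi].
Proof.
move=> _ tfG _ faithA faithB n3 phi_der centerA centerB no_ideal regular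
  noncomm special.
pose const_e : {ffun 'I_n -> gmatrix C} := [ffun=> e].
pose i : 'I_n := Ordinal (ltnW (ltnW n3)); pose j : 'I_n := Ordinal (ltnW n3).
have const_e_id h : subst_arg const_e h e = const_e.
  by rewrite subst_arg_id // ffunE.
have extX0 : extremal_elt X0.
  move=> u v; rewrite /X0 /e /f corner_ef corner_fe.
  have bD : lie_biderivation
      (fun a b => phi (subst_arg (subst_arg const_e i a) j b)).
    exact: n_lie_bider.
  have [] := extremal_ee faithA faithB no_ideal bD u v.
  rewrite /= !const_e_id => extM extN; rewrite lieDr extM add0r.
  rewrite lieMr ?extN ?mulr0 //; exact: central_sign.
have iter_e : iterated_lie X0 const_e =
    inM C (partM phie) + inN C (partN phie).
  rewrite /iterated_lie; under eq_bigr => h _ do rewrite ffunE.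
  rewrite big_const_ord /X0 /e /f corner_ef corner_fe iter_lie_e.
  - by rewrite mulrA -expr2 sqrr_sign mul1r.
  - exact: lie_e_inM.
  - by rewrite lieMr ?lie_e_inN ?mulrN //; apply: central_sign.
have psi_der :=
  sub_n_lie_derivation phi_der (iterated_lie_n_derivation n extX0).
have psi_e : central (phi const_e - iterated_lie X0 const_e).
  rewrite iter_e -/phie {1}(gm_split phie) -(addrA (diag phie)) addrK.
  have := lie_der_diag faithA faithB (phi_der.2 const_e i).
  by rewrite /= const_e_id.
have psi_central := n_lie_derivation_central tfG faithA faithB no_ideal centerA
  centerB special regular noncomm n3 psi_der psi_e.
exists (iterated_lie X0), (fun x => phi x - iterated_lie X0 x); split=> //.
- by move=> x; rewrite addrC subrK.
- exact: extremal_iterated_lie.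
- exact: psi_der.1.
- exact: n_lie_central_commutator psi_der psi_central.
Qed.
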